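(* Let $A$ and $B$ be commutative rings with unity, let $f: A\to B$ be a ring homomorphism, and let $J$ be an ideal of $B$. Let $A\Join^f J := \{(a, f(a)+j) \mid a\in A,\ j\in J\}$ (a subring of $A\times B$) and let $U := \operatorname{Spec}(B)\setminus V(J)$. Assume that $A\Join^f J$ has finite Krull dimension. Then $$\dim(A\Join^f J) \le \max\bigl\{\dim(A),\ \dim(A/f^{-1}(J)) + \min\{\dim(B),\ 1+\dim(U)\}\bigr\}$$ and $$\max\bigl\{\dim(A),\ \dim(A/f^{-1}(J)) + \min\{\dim(B),\ 1+\dim(U)\}\bigr\} \le \min\bigl\{\dim(A)+\dim(U)+1,\ \max\{\dim(A),\ \dim(A/f^{-1}(J))+\dim(B)\}\bigr\}.$$
   Context: All rings are commutative with unity. $\dim$ of a ring is its Krull dimension. $V(J)$ is the set of prime ideals of $B$ containing $J$. For a subset $U\subseteq \operatorname{Spec}(B)$, $\dim(U)$ is the supremum of the lengths $r$ of chains $Q_0\subsetneq Q_1\subsetneq\dots\subsetneq Q_r$ of primes belonging to $U$, with the convention $\dim(\emptyset)=-1$. *)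

(* Defs.v *)
From HB Require Import structures.
From mathcomp Require Import all_boot all_order all_algebra.
From mathcomp Require Import generic_quotient ring_quotient.
From mathcomp Require Import boolp classical_sets constructive_ereal.

Set Implicit Arguments.
Unset Strict Implicit.
Unset Printing Implicit Defensive.

Import Order.TTheory GRing.Theory Num.Theory.

Local Open Scope classical_set_scope.
Local Open Scope ring_scope.

(* Rings are [comPzRingType]s, so that the zero ring is allowed. The ideals of
   MathComp's [ring_quotient] are proper by definition and live in nonzero
   rings, hence the following notion, which includes the unit ideal. *)
Definition is_ideal (R : comPzRingType) (I : set R) : Prop :=
  [/\ I 0, forall x y, I x -> I y -> I (x + y)
    & forall a x, I x -> I (a * x)].

Record ideal (R : comPzRingType) := Ideal {
  ideal_set :> set R;
  idealP : is_ideal ideal_set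
}.

Definition prime_ideal (R : comPzRingType) (P : set R) : Prop :=
  [/\ is_ideal P, ~ P 1 & forall x y, P (x * y) -> P x \/ P y].

Definition Spec (R : comPzRingType) : set (set R) := [set P | prime_ideal P].

Definition V (R : comPzRingType) (J : set R) : set (set R) :=
  [set P | Spec P /\ J `<=` P].

Lemma preim_ideal_subproof (A B : comPzRingType) (f : {rmorphism A -> B})
  (J : ideal B) : is_ideal (f @^-1` J).
Proof.
have [J0 JD JM] := idealP J; split => [|x y Jx Jy|a x Jx] /=.
- by rewrite rmorph0.
- by rewrite rmorphD; exact: JD.
- by rewrite rmorphM; exact: JM.
Qed.

Definition preim_ideal (A B : comPzRingType) (f : {rmorphism A -> B})
  (J : ideal B) : ideal A := Ideal (preim_ideal_subproof f J).

Section QuotientRing.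
Local Open Scope quotient_scope.
Variables (R : comPzRingType) (I : ideal R).

Definition ideal_pred : {pred R} := fun x => `[< ideal_set I x >].

Lemma ideal_pred_zmod_closed : zmod_closed ideal_pred.
Proof.
have [I0 ID IM] := idealP I; split=> [|x y]; first exact/asboolP.
move=> /asboolP Ix /asboolP Iy; apply/asboolP; rewrite -mulN1r.
by apply: ID => //; exact: IM.
Qed.

HB.instance Definition _ :=
  GRing.isZmodClosed.Build R ideal_pred ideal_pred_zmod_closed.

Definition quot_ring : Type := Quotient.quot ideal_pred.

HB.instance Definition _ :=
  GRing.Zmodule.copy quot_ring (Quotient.quot ideal_pred).
HB.instance Definition _ :=
  EqQuotient.copy quot_ring (Quotient.quot ideal_pred).

Definition quot_one : quot_ring := \pi_quot_ring 1.
Definition quot_mul (x y : quot_ring) : quot_ring :=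
  \pi_quot_ring (repr x * repr y).

Lemma quot_piP (x y : R) :
  \pi_quot_ring x = \pi_quot_ring y <-> ideal_set I (x - y).
Proof.
split=> [/eqP|Ixy]; last by apply/eqP; rewrite -Quotient.idealrBE; exact/asboolP.
by rewrite -(Quotient.idealrBE ideal_pred) => /asboolP.
Qed.

Lemma quot_piM (x y : R) :
  \pi_quot_ring (x * y) = quot_mul (\pi_quot_ring x) (\pi_quot_ring y).
Proof.
have [I0 ID IM] := idealP I; apply/quot_piP.
set x' := repr _; set y' := repr _.
have -> : x * y - x' * y' = y * (x - x') + x' * (y - y').
  by rewrite !mulrBr [y * x]mulrC [y * x']mulrC addrA subrK.
by apply: ID; apply: IM; apply/quot_piP; rewrite reprK.
Qed.

Lemma quot_piD (x y : R) :
  \pi_quot_ring (x + y) = \pi_quot_ring x + \pi_quot_ring y.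
Proof. exact: (Quotient.pi_add ideal_pred). Qed.

Lemma quot_mulA : associative quot_mul.
Proof.
move=> x y z; rewrite -[x]reprK -[y]reprK -[z]reprK.
by rewrite -(quot_piM (repr y)) -(quot_piM (repr x) (repr y)) -!quot_piM mulrA.
Qed.

Lemma quot_mulC : commutative quot_mul.
Proof. by move=> x y; rewrite /quot_mul mulrC. Qed.

Lemma quot_mul1 : left_id quot_one quot_mul.
Proof. by move=> x; rewrite -[x]reprK -quot_piM mul1r. Qed.

Lemma quot_mulDl : left_distributive quot_mul +%R.
Proof.
move=> x y z; rewrite -[x]reprK -[y]reprK -[z]reprK.
by rewrite -quot_piD -!quot_piM -quot_piD mulrDl.
Qed.

HB.instance Definition _ := GRing.Zmodule_isComPzRing.Build quot_ring
  quot_mulA quot_mulC quot_mul1 quot_mulDl.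

End QuotientRing.

Section Amalgamation.
Variables (A B : comPzRingType) (f : {rmorphism A -> B}) (J : ideal B).

Definition amalg_pred : {pred A * B} :=
  fun x => `[< exists a j, ideal_set J j /\ x = (a, f a + j) >].

Lemma amalg_pred_subring_closed : subring_closed amalg_pred.
Proof.
have [J0 JD JM] := idealP J; split.
- by apply/asboolP; exists 1, 0; rewrite rmorph1 addr0.
- move=> _ _ /asboolP[a [j [Jj ->]]] /asboolP[b [k [Jk ->]]].
  apply/asboolP; exists (a - b), (j - k); split.
    by rewrite -mulN1r; apply: JD => //; exact: JM.
  by congr (_, _); rewrite /= rmorphB opprD addrACA.
- move=> _ _ /asboolP[a [j [Jj ->]]] /asboolP[b [k [Jk ->]]].
  apply/asboolP; exists (a * b), (f a * k + f b * j + j * k); split.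
    by apply: (JD); [apply: (JD)|]; exact: JM.
  congr (_, _); rewrite /= rmorphM mulrDr !mulrDl [j * f b]mulrC -!addrA.
  by congr (_ + _); rewrite addrCA.
Qed.

HB.instance Definition _ :=
  GRing.isSubringClosed.Build (A * B)%type amalg_pred amalg_pred_subring_closed.

Definition amalg : Type := {x : A * B | x \in amalg_pred}.

HB.instance Definition _ := SubChoice.on amalg.
HB.instance Definition _ := GRing.SubChoice_isSubComPzRing.Build _ _ amalg (GRing.subringClosedP amalg_pred).

End Amalgamation.

Definition chain (R : comPzRingType) (U : set (set R)) (r : nat)
  (Q : nat -> set R) : Prop :=
  (forall i, (i <= r)%N -> U (Q i)) /\
  (forall i, (i < r)%N -> Q i `<` Q i.+1).

Definition chain_lengths (R : comPzRingType) (U : set (set R)) : set (\bar int) :=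
  [set (r%:Z)%:E | r in [set r : nat | exists Q, chain U r Q]].

(* [supremum x0 S] is the least upper bound of [S], or [x0] if [S] is empty. *)
Definition dim_subset (R : comPzRingType) (U : set (set R)) : \bar int :=
  supremum (-1)%:E%E (chain_lengths U).

(* Supremum in {0, 1, ..., +oo}. The default value 0 is only used for the zero
   ring, every other ring having a prime ideal. It matters only when J = B, for
   the zero ring A/f^-1(J): with dimension -1 or -oo there, the first inequality
   would fail (A a field k, B = k[x], f the inclusion, J = B, where the
   amalgamation is k * k[x]). If J is proper, then A, B, A/f^-1(J) and the
   amalgamation are all nonzero. *)
Definition krull_dim (R : comPzRingType) : \bar int :=
  supremum 0%:E%E (chain_lengths (@Spec R)).

(* Main.v *)
(* Let D be the amalgamation. In a chain of primes of D, those not containing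
   0 x J come first, say Q_0 < ... < Q_k, and correspond to a chain of primes of
   B in U. Every later prime contains Q_k and 0 x J, hence also f^-1(J) x 0, which
   kills 0 x J; so the later primes form a chain in A/f^-1(J), of length
   r - (k + 1) if r is the length of the whole chain. When Q_(k+1) exists, the
   prime q of B corresponding to Q_k is not comaximal with J: if b + j = 1 with
   b in q and j in J, then (1, b) in Q_k and (0, j) sum to 1 in Q_(k+1). So q is
   not maximal, and extending the chain in B by one prime gives k + 1 <= dim B. *)
Require Import Defs.
From HB Require Import structures.
From mathcomp Require Import all_boot all_order all_algebra.
From mathcomp Require Import generic_quotient.
From mathcomp Require Import boolp classical_sets constructive_ereal.

Import Order.TTheory GRing.Theory Num.Theory.

Local Open Scope classical_set_scope.

(** * Ideals and the existence of primes above a proper ideal *)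

Section Ideals.
Local Open Scope ring_scope.
Context {R : comPzRingType}.
Implicit Types I M P : set R.

Lemma is_idealN I x : is_ideal I -> I x -> I (- x).
Proof. by case=> _ _ IM Ix; rewrite -mulN1r; exact: IM. Qed.

Lemma is_idealB I x y : is_ideal I -> I x -> I y -> I (x - y).
Proof. by move=> Iid Ix Iy; have [_ ID _] := Iid; apply: ID => //; apply: is_idealN. Qed.

Lemma is_ideal_subr I x y : is_ideal I -> I (x - y) -> I x <-> I y.
Proof.
move=> Iid Ixy; have [_ ID _] := Iid; split => [Ix|Iy].
  by rewrite -[y](subKr x); exact: is_idealB.
by rewrite -(subrK y x); exact: ID.
Qed.

Definition ideal_sum (I1 I2 : set R) : set R :=
  [set x | exists2 y, I1 y & exists2 z, I2 z & x = y + z].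

Lemma is_ideal_sum I1 I2 :
  is_ideal I1 -> is_ideal I2 -> is_ideal (ideal_sum I1 I2).
Proof.
move=> [z1 D1 M1] [z2 D2 M2]; split.
- by exists 0 => //; exists 0 => //; rewrite addr0.
- move=> _ _ [y Iy [z Iz ->]] [y' Iy' [z' Iz' ->]].
  by exists (y + y'); [exact: D1|exists (z + z'); [exact: D2|exact: addrACA]].
- move=> a _ [y Iy [z Iz ->]]; exists (a * y); first exact: M1.
  by exists (a * z); [exact: M2|exact: mulrDr].
Qed.

Lemma sub_ideal_suml I1 I2 : is_ideal I2 -> I1 `<=` ideal_sum I1 I2.
Proof. by move=> [z2 _ _] x Ix; exists x => //; exists 0; rewrite ?addr0. Qed.

Lemma sub_ideal_sumr I1 I2 : is_ideal I1 -> I2 `<=` ideal_sum I1 I2.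
Proof. by move=> [z1 _ _] x Ix; exists 0 => //; exists x; rewrite ?add0r. Qed.

Definition principal (x : R) : set R := [set y | exists r, y = r * x].

Lemma is_ideal_principal x : is_ideal (principal x).
Proof.
split; first by exists 0; rewrite mul0r.
- by move=> _ _ [r ->] [s ->]; exists (r + s); rewrite mulrDl.
- by move=> a _ [r ->]; exists (a * r); rewrite mulrA.
Qed.

(** If [x] lies outside [M], maximality puts 1 in the sum of [M] and the ideal of [x], say 1 = m + r
    x; then y = y m + r (x y) lies in [M]. *)
Lemma maximal_ideal_prime M :
    is_ideal M -> ~ M 1 ->
    (forall N, is_ideal N -> M `<` N -> N 1) ->
  prime_ideal M.
Proof.
move=> Mid M1 Mmax; have [_ MD MM] := Mid; split => // x y Mxy.
have [Mx|nMx] := pselect (M x); [by left|right].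
have Mid' := is_ideal_sum _ _ Mid (is_ideal_principal x).
have [|m Mm [_ [r ->] e1]] := Mmax _ Mid'.
  split; first exact/sub_ideal_suml/is_ideal_principal.
  move=> /(_ x) sub; apply/nMx/sub/sub_ideal_sumr => //.
  by exists 1; rewrite mul1r.
rewrite -[y]mulr1 e1 mulrDr; apply: (MD); first exact: MM.
by rewrite [y * _]mulrC -mulrA; exact: MM.
Qed.

Lemma prime_above I :
  is_ideal I -> ~ I 1 -> exists2 P, prime_ideal P & I `<=` P.
Proof.
move=> Iid I1; have [I0 ID IM] := Iid.
(* The union with [I] makes the empty chain satisfy the predicate given to Zorn's lemma. *)
have [F FP Ftot|X [[Xid X1] Xmax]] :=
    @Zorn_bigcup R (fun X => is_ideal (I `|` X) /\ ~ (I `|` X) 1).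
  split; last by case=> // -[X FX X1]; have [_] := FP _ FX; apply; right.
  have up X x : F X -> (I `|` X) x -> (I `|` \bigcup_(X in F) X) x.
    by move=> FX [?|?]; [left|right; exists X].
  split; first by left.
  - move=> x y [Ix|[X FX Xx]] [Iy|[Y FY Yy]].
    + by left; exact: ID.
    + by apply: (up Y) => //; have [[_ + _] _] := FP _ FY; apply; [left|right].
    + by apply: (up X) => //; have [[_ + _] _] := FP _ FX; apply; [right|left].
    + have [XY|YX] := Ftot _ _ FX FY.
        apply: (up Y) => //; have [[_ + _] _] := FP _ FY.
        by apply; right => //; exact: XY.
      apply: (up X) => //; have [[_ + _] _] := FP _ FX.
      by apply; right => //; exact: YX.
  - move=> a x [Ix|[X FX Xx]]; first by left; exact: IM.
    by apply: (up X) => //; have [[_ _ +] _] := FP _ FX; apply; right.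
exists (I `|` X); last exact: subsetUl.
apply: maximal_ideal_prime => // N Nid [subN nsubN].
(* If [N] omitted 1, then, being equal to its union with [I], it would be an admissible set strictly
   larger than [X]. *)
apply: contrapT => N1; apply: (Xmax N); last first.
  by rewrite (_ : I `|` N = N) //; apply/setUidPr => x Ix; apply: subN; left.
split=> [x Xx|NX]; first by apply: subN; right.
by apply: nsubN => x /NX; right.
Qed.

End Ideals.

(** * Suprema of chain lengths and operations on chains *)

Section Dimension.
Local Open Scope ring_scope.
Local Open Scope ereal_scope.

(** [supremum] selects a least upper bound by choice, so one has to be exhibited: the largest length
    if there is one, [+oo] otherwise. *)
Lemma chain_lengths_supremum (x0 : \bar int) {R : comPzRingType}
    (U : set (set R)) :
  chain_lengths U !=set0 ->
  supremums (chain_lengths U) (supremum x0 (chain_lengths U)).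
Proof.
move=> U0; rewrite /supremum ifF; last by apply/negbTE/set0P.
apply: xgetPex; set L := [set r | exists Q, chain U r Q].
have [[m [Lm mP]]|noub] :=
    pselect (exists m, L m /\ forall r, L r -> (r <= m)%N).
  exists m%:Z%:E; split; first by move=> _ [r Lr <-]; rewrite lee_fin lez_nat mP.
  by move=> y; apply; exists m.
exists +oo; split=> [x _|y yub]; first exact: leey.
(* As no length is the largest, induction on [n] finds lengths beyond every bound. *)
have unb n : exists2 r, L r & (n <= r)%N.
  elim: n => [|n [r Lr nr]]; first by have [_ [r Lr _]] := U0; exists r.
  apply: contrapT => nex; apply: noub; exists r; split => // s Ls.
  rewrite leqNgt; apply/negP => rs; apply: nex; exists s => //.
  exact: leq_ltn_trans rs.
(* No upper bound is below [+oo]: [-oo] fails against any length, and an integer [y] against a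
   length of at least |y| + 1. *)
case: y yub => [y| |] yub //; last first.
  have [r Lr _] := unb 0%N.
  by have := yub _ (ex_intro2 _ _ r Lr erefl).
have [r Lr yr] := unb `|y|%N.+1.
have := yub _ (ex_intro2 _ _ r Lr erefl); rewrite lee_fin => ry.
have : (r%:Z <= `|y|%N)%R by rewrite (le_trans ry) // abszE ler_norm.
by rewrite lez_nat leqNgt yr.
Qed.

Lemma chain_le_supremum (x0 : \bar int) {R : comPzRingType} (U : set (set R))
    r Q :
  chain U r Q -> r%:Z%:E <= supremum x0 (chain_lengths U).
Proof.
move=> cQ; have Lr : chain_lengths U r%:Z%:E by exists r => //; exists Q.
by have [+ _] := chain_lengths_supremum x0 U (ex_intro _ _ Lr); apply.
Qed.

Lemma supremum_chain_le (x0 y : \bar int) {R : comPzRingType}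
    (U : set (set R)) :
  x0 <= y -> (forall r Q, chain U r Q -> r%:Z%:E <= y) ->
  supremum x0 (chain_lengths U) <= y.
Proof.
move=> x0y yub; have [->|/set0P U0] := eqVneq (chain_lengths U) set0.
  by rewrite supremum0.
have [_] := chain_lengths_supremum x0 U U0; apply => _ [r [Q cQ] <-].
exact: yub cQ.
Qed.

Lemma supremum_chain_ge (x0 : \bar int) {R : comPzRingType} (U : set (set R)) :
  x0 <= 0 -> x0 <= supremum x0 (chain_lengths U).
Proof.
move=> x0le; have [->|/set0P[_ [r [Q cQ] _]]] := eqVneq (chain_lengths U) set0.
  by rewrite supremum0.
apply: (le_trans x0le); apply: (le_trans _ (chain_le_supremum _ _ _ _ cQ)).
by rewrite lee_fin.
Qed.

Lemma krull_dim_ge0 (R : comPzRingType) : 0 <= krull_dim R.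
Proof. exact: supremum_chain_ge. Qed.

Lemma dim_subset_geN1 {R : comPzRingType} (U : set (set R)) :
  (-1)%:E <= dim_subset U.
Proof. by apply: supremum_chain_ge; rewrite lee_fin. Qed.

Lemma chain_map {R S : comPzRingType} (phi : set R -> set S)
    (U : set (set R)) (W : set (set S)) r Q :
    (forall P, U P -> W (phi P)) ->
    (forall P P', U P -> U P' -> P `<` P' -> phi P `<` phi P') ->
  chain U r Q -> chain W r (phi \o Q).
Proof.
move=> UW mono [UQ ltQ]; split => i ir; first exact/UW/UQ.
by apply: mono; [apply: UQ; exact: ltnW|exact: UQ|exact: ltQ].
Qed.

Lemma chain_subset {R : comPzRingType} {U W : set (set R)} {r Q} :
  (forall i, (i <= r)%N -> W (Q i)) -> chain U r Q -> chain W r Q.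
Proof. by move=> WQ [_ ltQ]. Qed.

Lemma chain_take {R : comPzRingType} {U : set (set R)} {r Q} k :
  (k <= r)%N -> chain U r Q -> chain U k Q.
Proof.
move=> kr [UQ ltQ]; split => i ik; first by apply: UQ; exact: leq_trans kr.
by apply: ltQ; exact: leq_trans kr.
Qed.

Lemma chain_drop {R : comPzRingType} {U : set (set R)} {r Q} k :
  (k <= r)%N -> chain U r Q -> chain U (r - k) (fun i => Q (k + i)%N).
Proof.
move=> kr [UQ ltQ]; split => i ik; first by apply: UQ; rewrite -leq_subRL.
by rewrite addnS; apply: ltQ; rewrite -ltn_subRL.
Qed.

Lemma chain_mono {R : comPzRingType} {U : set (set R)} {r Q} i j :
  chain U r Q -> (i <= j)%N -> (j <= r)%N -> Q i `<=` Q j.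
Proof.
move=> [_ ltQ]; elim: j => [|j IH]; first by rewrite leqn0 => /eqP -> _ x.
rewrite leq_eqVlt => /orP[/eqP -> _ x //|ij jr].
by apply: (subset_trans (IH ij (ltnW jr))); have [] := ltQ j jr.
Qed.

Lemma chain_rcons {R : comPzRingType} {U : set (set R)} {r Q} P :
  chain U r Q -> U P -> Q r `<` P ->
  chain U r.+1 (fun i => if (i <= r)%N then Q i else P).
Proof.
move=> [UQ ltQ] UP ltP; split => i; first by case: ifP => [/UQ|].
rewrite ltnS => ir; rewrite ir; case: ifP => [/ltQ//|/negbT].
by rewrite -ltnNge ltnS => ri; rewrite (_ : i = r) //; apply/eqP; rewrite eqn_leq ir ri.
Qed.

End Dimension.

(** * Primes under preimages and quotients *)

Section PrimeMaps.
Local Open Scope ring_scope.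
Local Open Scope quotient_scope.

Lemma prime_preim {R S : comPzRingType} (g : {rmorphism R -> S}) P :
  prime_ideal P -> prime_ideal (g @^-1` P).
Proof.
move=> [Pid P1 PM]; split; first exact: (preim_ideal_subproof g (Ideal Pid)).
- by rewrite /= rmorph1.
- by move=> x y; rewrite /= rmorphM; exact: PM.
Qed.

Context {R : comPzRingType} (I : ideal R).

Definition quot_map (x : R) : quot_ring I := \pi_(quot_ring I) x.

Lemma quot_map_is_zmod_morphism : zmod_morphism quot_map.
Proof.
move=> x y; apply/(addIr (quot_map y)).
by rewrite /quot_map -quot_piD !subrK.
Qed.

Lemma quot_map_is_monoid_morphism : monoid_morphism quot_map.
Proof. by split=> // x y; exact: quot_piM. Qed.

HB.instance Definition _ :=
  GRing.isZmodMorphism.Build R (quot_ring I) quot_map quot_map_is_zmod_morphism.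
HB.instance Definition _ :=
  GRing.isMonoidMorphism.Build R (quot_ring I) quot_map
    quot_map_is_monoid_morphism.

(** The image of [P] in the quotient, read off the chosen representatives. When [P] is an ideal
    containing [I], the choice is irrelevant, since representatives of a class differ by an element
    of [I]. *)
Definition quot_ideal (P : set R) : set (quot_ring I) := [set x | P (repr x)].

Lemma quot_idealE {P : set R} a :
  is_ideal P -> I `<=` P -> quot_ideal P (quot_map a) <-> P a.
Proof.
move=> Pid IP; apply: (is_ideal_subr _ _ _ Pid); apply: IP; apply/quot_piP.
by rewrite reprK.
Qed.

Lemma quot_map_surj x : exists a, x = quot_map a.
Proof. by exists (repr x); rewrite /quot_map reprK. Qed.

Lemma quot_ideal_prime {P : set R} :
  prime_ideal P -> I `<=` P -> prime_ideal (quot_ideal P).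
Proof.
move=> [Pid P1 PM] IP; have qE a := quot_idealE a Pid IP.
have [P0 PD Pmul] := Pid; split; [split|..].
- by rewrite -[0](rmorph0 quot_map); apply/qE.
- move=> x y; have [a ->] := quot_map_surj x; have [b ->] := quot_map_surj y.
  by rewrite -rmorphD !qE; exact: PD.
- move=> x y; have [a ->] := quot_map_surj x; have [b ->] := quot_map_surj y.
  by rewrite -rmorphM !qE; exact: Pmul.
- by rewrite -[1](rmorph1 quot_map) qE.
- move=> x y; have [a ->] := quot_map_surj x; have [b ->] := quot_map_surj y.
  by rewrite -rmorphM !qE; exact: PM.
Qed.

Lemma chain_quot r Q :
  chain (V I) r Q -> chain (@Spec (quot_ring I)) r (quot_ideal \o Q).
Proof.
apply: chain_map => [P [Pp IP]|P P' [Pp IP] [Pp' IP'] [sPP' nsPP']].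
  exact: quot_ideal_prime.
have [[Pid _ _] [Pid' _ _]] := (Pp, Pp').
split=> [x|sub]; first exact: sPP'.
apply: nsPP' => a; rewrite -(quot_idealE a Pid') // -(quot_idealE a Pid) //.
exact: sub.
Qed.

(** Primes of the quotient pull back to primes of [R], and surjectivity of [quot_map] keeps
    inclusions strict. *)
Lemma krull_dim_quot_le : (krull_dim (quot_ring I) <= krull_dim R)%E.
Proof.
apply: supremum_chain_le => [|r Q cQ]; first exact: krull_dim_ge0.
apply: (@chain_le_supremum _ _ _ _ (preimage quot_map \o Q)).
apply: chain_map cQ => [P|P P' _ _ [sPP' nsPP']]; first exact: prime_preim.
split=> [a|sub]; first exact: sPP'.
by apply: nsPP' => x; have [a ->] := quot_map_surj x; exact: sub.
Qed.

End PrimeMaps.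

(** * Elements of the amalgamation; its primes over 0 x J and its other primes *)

Section Amalgamation.
Local Open Scope ring_scope.
Context {A B : comPzRingType} (f : {rmorphism A -> B}) (J : ideal B).
Local Notation D := (amalg f J).
Implicit Types P : set D.

(* [insubd] returns the junk value [0] unless [ideal_set J (x.2 - f x.1)]. *)
Definition amalg_in (x : A * B) : D := insubd 0 x.

Lemma amalg_inK (x : A * B) : ideal_set J (x.2 - f x.1) -> val (amalg_in x) = x.
Proof.
move=> Jx; apply: insubdK; apply/asboolP; exists x.1, (x.2 - f x.1).
by split=> //; rewrite addrC subrK; case: (x).
Qed.

Lemma amalgP (x : D) : ideal_set J ((val x).2 - f (val x).1).
Proof. by have /asboolP[a [j [Jj ->]]] := valP x; rewrite /= addrC addKr. Qed.

Definition amalg_diag (a : A) : D := amalg_in (a, f a).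
Definition amalg_zero (j : B) : D := amalg_in (0, j).

Lemma val_amalg_diag a : val (amalg_diag a) = (a, f a).
Proof. by rewrite amalg_inK //= subrr; case: (idealP J). Qed.

Lemma val_amalg_zero j : ideal_set J j -> val (amalg_zero j) = (0, j).
Proof. by move=> Jj; rewrite amalg_inK //= rmorph0 subr0. Qed.

Lemma amalg_zero0 : amalg_zero 0 = 0.
Proof. by apply: val_inj; rewrite val_amalg_zero //; case: (idealP J). Qed.

Lemma val_amalgD (x y : D) : val (x + y) = ((val x).1 + (val y).1, (val x).2 + (val y).2).
Proof. exact: rmorphD. Qed.

Lemma val_amalgM (x y : D) : val (x * y) = ((val x).1 * (val y).1, (val x).2 * (val y).2).
Proof. exact: rmorphM. Qed.

Lemma amalg_diag_is_zmod_morphism : zmod_morphism amalg_diag.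
Proof.
move=> a b; apply: (addIr (amalg_diag b)); rewrite subrK; apply: val_inj.
by rewrite val_amalgD !val_amalg_diag /= -rmorphD subrK.
Qed.

Lemma amalg_diag_is_monoid_morphism : monoid_morphism amalg_diag.
Proof.
split=> [|a b]; apply: val_inj; first by rewrite val_amalg_diag rmorph1 rmorph1.
by rewrite val_amalgM !val_amalg_diag /= rmorphM.
Qed.

HB.instance Definition _ :=
  GRing.isZmodMorphism.Build A D amalg_diag amalg_diag_is_zmod_morphism.
HB.instance Definition _ :=
  GRing.isMonoidMorphism.Build A D amalg_diag amalg_diag_is_monoid_morphism.

Lemma amalg_zeroMl (x : D) j :
  ideal_set J j -> x * amalg_zero j = amalg_zero ((val x).2 * j).
Proof.
move=> Jj; have [_ _ JM] := idealP J; apply: val_inj.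
by rewrite val_amalgM !val_amalg_zero //= ?mulr0 //; exact: JM.
Qed.

Lemma amalg_zeroD j k : ideal_set J j -> ideal_set J k ->
  amalg_zero (j + k) = amalg_zero j + amalg_zero k.
Proof.
move=> Jj Jk; have [_ JD _] := idealP J; apply: val_inj.
by rewrite val_amalgD !val_amalg_zero //= ?addr0 //; exact: JD.
Qed.

Lemma amalg_decomp (x : D) :
  x = amalg_diag (val x).1 + amalg_zero ((val x).2 - f (val x).1).
Proof.
apply: val_inj; rewrite val_amalgD val_amalg_diag val_amalg_zero; last exact: amalgP.
by rewrite /= addr0 addrC subrK; case: (val x).
Qed.


(** Divides the primes of [D] into two kinds: those satisfying it are compared with primes of [A]
    through [amalg_diag], the others with primes of [B] through [to_B]. *)
Definition over_zeroJ : set (set D) :=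
  [set P | forall j, ideal_set J j -> P (amalg_zero j)].

Lemma not_over_zeroJ P :
  ~ over_zeroJ P -> exists2 j, ideal_set J j & ~ P (amalg_zero j).
Proof.
by move=> /existsNP[j /not_implyP[Jj nPj]]; exists j.
Qed.

(** An element (a, b) differs from (a, f a) by (0, b - f a), which lies in 0 x J. Hence such a [P]
    is determined by its contraction to [A]. *)
Lemma over_zeroJE P x : is_ideal P -> over_zeroJ P ->
  P (amalg_diag (val x).1) <-> P x.
Proof.
move=> Pid PJ; apply: is_ideal_subr => //; rewrite -opprB.
apply: is_idealN => //; rewrite {1}[x]amalg_decomp addrC addKr.
exact/PJ/amalgP.
Qed.

Lemma preim_diag_lt P P' : prime_ideal P -> prime_ideal P' ->
  over_zeroJ P -> over_zeroJ P' -> P `<` P' ->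
  amalg_diag @^-1` P `<` amalg_diag @^-1` P'.
Proof.
move=> [Pid _ _] [Pid' _ _] PJ PJ' [sPP' nsPP']; split=> [a|sub].
  exact: sPP'.
by apply: nsPP' => x P'x; apply/(over_zeroJE _ _ Pid PJ)/sub/over_zeroJE.
Qed.

(** For f a in [J], write (a, f a) = (a, 0) + (0, f a). The second term lies in 0 x J. The first
    multiplies some (0, j) outside [P] to 0, so it lies in [P], hence in [P']. *)
Lemma sub_preim_diag P P' : prime_ideal P -> ~ over_zeroJ P ->
  is_ideal P' -> over_zeroJ P' -> P `<=` P' ->
  preim_ideal f J `<=` amalg_diag @^-1` P'.
Proof.
move=> [[P0 _ _] _ PM] /not_over_zeroJ[j Jj nPj] [_ PD' _] PJ' sPP' a /= Jfa.
have [J0 _ _] := idealP J.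
have va : val (amalg_in (a, 0)) = (a, 0).
  by rewrite amalg_inK //= sub0r; apply: is_idealN => //; exact: idealP.
have -> : amalg_diag a = amalg_in (a, 0) + amalg_zero (f a).
  apply: val_inj; rewrite val_amalgD val_amalg_diag va val_amalg_zero //=.
  by rewrite addr0 add0r.
apply: PD'; last exact: PJ'.
have [|/sPP'//|//] := PM (amalg_in (a, 0)) (amalg_zero j).
by rewrite amalg_zeroMl // va mul0r amalg_zero0.
Qed.

(** The b with 0 x bJ inside [P]. For a prime [P] not containing 0 x J this is the prime of [B]
    whose preimage under the second projection is [P], as [to_BE] and [to_B_U] show. *)
Definition to_B P : set B :=
  [set b | forall j, ideal_set J j -> P (amalg_zero (b * j))].

Lemma to_BE P x : prime_ideal P -> ~ over_zeroJ P -> to_B P (val x).2 <-> P x.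
Proof.
move=> [[_ _ Pmul] _ PM] /not_over_zeroJ[k Jk nPk]; split=> [Px|Px j Jj].
  by have := Px k Jk; rewrite -amalg_zeroMl // => /PM[].
by rewrite -amalg_zeroMl // mulrC; exact: Pmul.
Qed.

(** A [k] in [J] with (0, k) outside [P] witnesses that neither 1 nor all of [J] lies in
    [to_B P]. *)
Lemma to_B_U P : prime_ideal P -> ~ over_zeroJ P -> (@Spec B `\` V J) (to_B P).
Proof.
move=> Pp nPJ; have [[P0 PD Pmul] _ PM] := Pp.
have [J0 JD JM] := idealP J; have [k Jk nPk] := not_over_zeroJ _ nPJ.
have vk := val_amalg_zero _ Jk.
split; last first.
  case=> _ /(_ _ Jk); have := to_BE _ (amalg_zero k) Pp nPJ.
  by rewrite vk /= => /[apply].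
split; first split.
- by move=> j Jj; rewrite mul0r amalg_zero0.
- move=> x y Px Py j Jj; rewrite mulrDl amalg_zeroD; try exact: JM.
  by apply: PD; [exact: Px|exact: Py].
- move=> a x Px j Jj; rewrite -mulrA [a * _]mulrC -mulrA.
  by apply: Px; rewrite mulrC; exact: JM.
- by move=> /(_ _ Jk); rewrite mul1r.
- move=> x y Pxy; apply: contrapT => /not_orP[].
  move=> /existsNP[j /not_implyP[Jj nPj]] /existsNP[i /not_implyP[Ji nPi]].
  (* Since (x y)(j i) = (x j)(y i), the product of (0, x j) and (0, y i), both outside [P], would
     lie in [P]. *)
  have := Pxy (j * i) (JM _ _ Ji).
  rewrite -(mulrA x) (mulrA y) (mulrC y) -(mulrA j) mulrA.
  rewrite (_ : amalg_zero _ = amalg_zero (x * j) * amalg_zero (y * i)).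
    by move=> /PM[].
  by rewrite amalg_zeroMl ?val_amalg_zero //; exact: JM.
Qed.

Lemma to_B_lt P P' : prime_ideal P -> prime_ideal P' ->
  ~ over_zeroJ P -> ~ over_zeroJ P' -> P `<` P' -> to_B P `<` to_B P'.
Proof.
move=> Pp Pp' nPJ nPJ' [sPP' nsPP']; split=> [b Pb j Jj|sub].
  exact/sPP'/Pb.
by apply: nsPP' => x P'x; apply/(to_BE _ _ Pp nPJ)/sub/to_BE.
Qed.

(** [N] is a prime above the sum of [to_B P] and [J]; it is strictly larger than [to_B P] because it
    contains [J]. *)
Lemma to_B_not_maximal P P' : prime_ideal P -> prime_ideal P' ->
  ~ over_zeroJ P -> over_zeroJ P' -> P `<=` P' ->
  exists2 N, prime_ideal N & to_B P `<` N.
Proof.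
move=> Pp [[P0' PD' PM'] P1' _] nPJ PJ' sPP'.
have [[Bid B1 BM] nJB] := to_B_U P Pp nPJ; have Jid := idealP J.
have [||N Np sN] := prime_above (ideal_sum (to_B P) J).
- exact: is_ideal_sum.
- case=> q Pq [j Jj e1]; apply: P1'.
  (* The pair (1, q) belongs to [D] because q - f 1 = -j lies in [J]. *)
  have vq : val (amalg_in (1, q)) = (1, q).
    rewrite amalg_inK //= rmorph1 e1 opprD addrA subrr sub0r.
    exact: is_idealN.
  have -> : 1 = amalg_in (1, q) + amalg_zero j.
    by apply: val_inj; rewrite val_amalgD vq val_amalg_zero //= addr0 -e1.
  apply: PD'; last exact: PJ'.
  by apply: sPP'; apply/to_BE => //; rewrite vq.
exists N => //; split; first exact/(subset_trans _ sN)/sub_ideal_suml.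
move=> NB; apply: nJB; split => // j Jj.
by apply/NB/sN/sub_ideal_sumr.
Qed.

End Amalgamation.

(** * Bounding one chain of primes of the amalgamation *)

Lemma chain_length_amalg_le {A B : comPzRingType} (f : {rmorphism A -> B})
    (J : ideal B) r Q :
  chain (@Spec (amalg f J)) r Q ->
  (r%:Z%:E <= Order.max (krull_dim A)
    (krull_dim (quot_ring (preim_ideal f J))
     + Order.min (krull_dim B) (1 + dim_subset (@Spec B `\` V J))))%E.
Proof.
move=> cQ; have [Qp ltQ] := cQ; set U := _ `\` _.
have cU k : (k <= r)%N -> (forall i, (i <= k)%N -> ~ over_zeroJ f J (Q i)) ->
    chain U k (to_B f J \o Q).
  move=> kr nJ; have cN := chain_take k kr cQ.
  have {}cN : chain (@Spec _ `\` over_zeroJ f J) k Q.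
    by apply: chain_subset cN => i ik; split; [exact/Qp/(leq_trans ik)|exact: nJ].
  apply: chain_map cN => [P [Pp nPJ]|P P' [Pp nPJ] [Pp' nPJ']].
    exact: to_B_U.
  exact: to_B_lt.
have UB k T : chain U k T -> chain (@Spec B) k T.
  by move=> cT; apply: (chain_subset _ cT) => i ik; have [/(_ i ik)[]] := cT.
have dimU k T : chain U k T -> (k.+1%:Z%:E <= 1 + dim_subset U)%E.
  by move=> cT; rewrite intS EFinD leeD2l //; exact: chain_le_supremum cT.
have dimB k T : chain U k T -> (k%:Z%:E <= krull_dim B)%E.
  by move=> /UB; exact: chain_le_supremum.
(* If no prime of the chain contains 0 x J, the whole chain maps into [U]; its length is at most
   both dim B and 1 + dim U, and the quotient term is nonnegative. *)
have [[k0 [k0r k0J]]|nJ] :=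
    pselect (exists k, (k <= r)%N /\ over_zeroJ f J (Q k)); last first.
  rewrite le_max; apply/orP; right.
  have cT : chain U r (to_B f J \o Q).
    by apply: cU => // i ir QJ; apply: nJ; exists i.
  apply: (@le_trans _ _ (0 + r%:Z%:E)%E); first by rewrite add0e.
  apply: leeD; first exact: krull_dim_ge0.
  rewrite le_min (dimB _ _ cT) /=; apply: le_trans (dimU _ _ cT).
  by rewrite lee_fin lez_nat.
have exk : exists k, (k <= r)%N && `[< over_zeroJ f J (Q k) >].
  by exists k0; rewrite k0r; apply/asboolP.
(* The chain is cut at the first prime containing 0 x J. *)
have [k /andP[kr /asboolP kJ] kmin] := ex_minnP exk.
have geJ i : (k <= i)%N -> (i <= r)%N -> over_zeroJ f J (Q i).
  by move=> ki ir j Jj; apply: (chain_mono k i cQ) => //; exact: kJ.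
have {}cA : chain [set P | Spec P /\ over_zeroJ f J P] (r - k) (fun i => Q (k + i)%N).
  apply: chain_subset (chain_drop k kr cQ) => i ik.
  have kir : (k + i <= r)%N by rewrite -leq_subRL.
  by split; [exact: Qp|apply: geJ => //; exact: leq_addr].
have {}cA : chain (@Spec A) (r - k) (preimage (amalg_diag f J) \o (fun i => Q (k + i)%N)).
  apply: chain_map cA => [P [Pp _]|P P' [Pp PJ] [Pp' PJ']].
    exact: prime_preim.
  exact: preim_diag_lt.
(* If the cut is at 0, the whole chain contracts to [A]. Otherwise the cut becomes [k.+1], and [Q k]
   is the last prime not containing 0 x J. *)
case: k => [|k] in kr kJ kmin geJ cA *.
  by rewrite le_max; apply/orP; left; rewrite subn0 in cA; exact: chain_le_supremum cA.
have ltJ i : (i <= k)%N -> ~ over_zeroJ f J (Q i).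
  move=> ik iJ; have := kmin i; rewrite (leq_trans ik (ltnW kr)).
  by rewrite (introT (asboolP _) iJ) => /(_ isT); rewrite ltnNge ik.
have kS := ltnW kr.
have cT := cU k kS ltJ.
rewrite le_max; apply/orP; right.
(* The length splits as (r - (k + 1)) + (k + 1): the tail is bounded in the quotient of [A], and the
   strict inclusion from [Q k] to [Q k.+1] is charged to the head. *)
rewrite -(subnK kr) PoszD EFinD; apply: leeD.
  pose cq := chain_quot (preim_ideal f J).
  apply: (chain_le_supremum _ _ _ _ (cq _ _ (chain_subset _ cA))) => i ir.
  have kir : (k.+1 + i <= r)%N by rewrite -leq_subRL.
  have [cAp _] := cA; split; first exact: cAp.
  apply: (sub_preim_diag f J (Q k)) => //.
  - exact: Qp.
  - exact: ltJ.
  - by have [] := Qp _ kir.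
  - by apply: geJ => //; exact: leq_addr.
  - by apply: (chain_mono _ _ cQ) => //; exact: leq_trans (leq_addr _ _).
rewrite le_min (dimU _ _ cT) andbT.
(* The head has length only [k] in [B]; appending [N] yields k + 1. *)
have [N Np ltN] : exists2 N, prime_ideal N & to_B f J (Q k) `<` N.
  apply: (to_B_not_maximal f J _ (Q k.+1)) => //; try exact: Qp.
    exact: ltJ.
  by have [] := ltQ k kr.
exact: chain_le_supremum (chain_rcons N (UB _ _ cT) Np ltN).
Qed.

(** * The two inequalities *)

Local Open Scope ereal_scope.

Theorem theorem4p9 (A B : comPzRingType) (f : {rmorphism A -> B}) (J : ideal B)
  (finite_dim : krull_dim (amalg f J) \is a fin_num) :
  let U := @Spec B `\` V J in
  let M := Order.max (krull_dim A)
             (krull_dim (quot_ring (preim_ideal f J))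
              + Order.min (krull_dim B) (1 + dim_subset U)) in
  krull_dim (amalg f J) <= M /\
  M <= Order.min (krull_dim A + dim_subset U + 1)
         (Order.max (krull_dim A)
            (krull_dim (quot_ring (preim_ideal f J)) + krull_dim B)).
Proof.
move=> U M; split.
  apply: supremum_chain_le => [|r Q]; last exact: chain_length_amalg_le.
  by rewrite le_max krull_dim_ge0.
(* The value -1 for the empty set is the lowest that dim U can take, so adding 1 to dim U gives a
   nonnegative term. *)
have U0 : 0 <= 1 + dim_subset U.
  by apply: le_trans (leeD2l 1 (dim_subset_geN1 U)); rewrite lee_fin.
rewrite le_min !ge_max -addeA [dim_subset U + 1]addeC; apply/andP; split.
  (* Here dim A absorbs the quotient term and the minimum is at most 1 + dim U; for the other bound
     the minimum is at most dim B. *)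
  rewrite leeDl //=; apply: leeD; first exact: krull_dim_quot_le.
  by rewrite ge_min lexx orbT.
by rewrite le_max lexx /= le_max leeD2l ?orbT // ge_min lexx.
Qed.
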